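(* Let $d\ge4$. Let $(a_t,b_t)\in\mathbb N^2$ ($t=1,\dots,m$) be pairwise distinct pairs satisfying $1\le a_t\le b_t$ and $a_t+b_t\le d$, and set $$X:=\bigsqcup_{t=1}^m\mathcal O^{(d)}_{a_t,b_t}\subset G_{2,d}.$$ Then the following are equivalent: (i) $X$ is an equal-weight tight $2$-fusion frame. (ii) $$\sum_{t=1}^mN_d(a_t,b_t)\,\Delta\bigl(\mathcal O^{(d)}_{a_t,b_t}\bigr)=0.$$
   Context: $G_{2,d}$ is the set of $2$-dimensional linear subspaces of $\mathbb R^d$; $P_W$ is the orthogonal projection onto $W$; $e_1,\dots,e_d$ is the standard basis of $\mathbb R^d$. The hyperoctahedral group $B_d=\{\pm1\}^d\rtimes S_d\subset O(d)$ acts on $\mathbb R^d$ by signed coordinate permutations and on $G_{2,d}$ by $g\cdot W=gW$. For integers $1\le a\le b$ with $a+b\le d$, let $u_0=\frac1{\sqrt a}\sum_{i=1}^ae_i$, $v_0=\frac1{\sqrt b}\sum_{j=a+1}^{a+b}e_j$, $W_0=\mathrm{span}(u_0,v_0)$, and define $\mathcal O^{(d)}_{a,b}:=B_d\cdot W_0\subset G_{2,d}$ (a finite orbit) and $N_d(a,b):=|\mathcal O^{(d)}_{a,b}|$. (For distinct pairs as in the claim, these orbits are pairwise disjoint.) For a nonempty finite set $X\subset G_{2,d}$ put $F_X(x):=\frac1{|X|}\sum_{W\in X}\|P_Wx\|^4$ for $x\in\mathbb R^d$, and $\Delta(X):=F_X(e_1)-F_X\bigl(\frac{e_1+e_2}{\sqrt2}\bigr)$.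 A finite set $X\subset G_{2,d}$ is an equal-weight tight $2$-fusion frame ($\mathrm{TFF}_2$) if there is a constant $A>0$ with $\sum_{W\in X}\|P_Wx\|^4=A\|x\|^4$ for all $x\in\mathbb R^d$. *)

(* Defs.v *)
From HB Require Import structures.
From mathcomp Require Import all_boot all_order all_algebra perm.
From mathcomp Require Import finmap reals.

Set Implicit Arguments.
Unset Strict Implicit.
Unset Printing Implicit Defensive.

Import Order.TTheory GRing.Theory Num.Theory.
Local Open Scope ring_scope.

(* Vectors of R^d are row vectors 'rV[R]_d, linear subspaces are
   {vspace 'rV[R]_d}, and finite sets of subspaces are finite sets (fset) of
   such vspaces. *)

Section Euclidean.
Variables (R : realType) (d : nat).
Implicit Types (u v x y : 'rV[R]_d) (W : {vspace 'rV[R]_d}).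

Definition dotp u v : R := \sum_(i < d) u 0 i * v 0 i.

Lemma dotpC u v : dotp u v = dotp v u.
Proof. by apply: eq_bigr => i _; rewrite mulrC. Qed.

Fact dotp_is_bilinear :
  bilinear_for ( *%R : R -> R -> R ) (idfun \; *%R : R -> R -> R) dotp.
Proof.
have linl v a x y : dotp (a *: x + y) v = a * dotp x v + dotp y v.
  rewrite /dotp mulr_sumr -big_split; apply: eq_bigr => i _ /=.
  by rewrite !mxE mulrDl mulrA.
by split=> v a x y /=; rewrite ?linl // !(dotpC v) linl.
Qed.
HB.instance Definition _ :=
  bilinear_isBilinear.Build R 'rV[R]_d 'rV[R]_d R
    ( *%R : R -> R -> R ) (idfun \; *%R : R -> R -> R) dotp dotp_is_bilinear.

Fact dotp_is_sym u v : dotp u v = (-1) ^+ false * idfun (dotp v u).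
Proof. by rewrite mul1r dotpC. Qed.
HB.instance Definition _ :=
  isHermitianSesquilinear.Build R 'rV[R]_d false idfun dotp dotp_is_sym.

Fact dotp_gt0 u : u != 0 -> 0 < dotp u u.
Proof.
case/rV0Pn=> i ui0; rewrite /dotp (bigD1 i) //= ltr_wpDr //.
  by apply: sumr_ge0 => j _; rewrite -expr2 sqr_ge0.
by rewrite -expr2 lt_def sqr_ge0 sqrf_eq0 ui0.
Qed.
HB.instance Definition _ := isDotProduct.Build R 'rV[R]_d dotp dotp_gt0.

(* Euclidean norm; `|x| on 'rV[R]_d would be the sup norm. *)
Definition norm2 x : R := Num.sqrt (dotp x x).

Definition orthocompl W : {vspace 'rV[R]_d} :=
  orthov (dotp : {hermitian 'rV[R]_d for false & idfun}) W.

Definition orthoproj W : 'End('rV[R]_d) := daddv_pi W (orthocompl W).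

Lemma mem_orthocomplP W x :
  reflect (forall w, w \in W -> dotp x w = 0) (x \in orthocompl W).
Proof. exact: mem_orthovP. Qed.

Lemma orthocompl_cap W : (W :&: orthocompl W = 0)%VS.
Proof.
apply/eqP; rewrite -subv0; apply/subvP=> x; rewrite memv_cap memv0.
case/andP=> xW /mem_orthocomplP/(_ x xW) xx0.
by apply: contraTT isT => /dotp_gt0; rewrite xx0 ltxx.
Qed.

Lemma orthocompl_add W : (W + orthocompl W = fullv)%VS.
Proof.
apply/eqP; rewrite eqEdim subvf dimv_disjoint_sum ?orthocompl_cap //=.
pose M : 'M[R]_(d, \dim W) := \matrix_(k, i) (vbasis W)`_i 0 k.
pose f : 'Hom('rV[R]_d, 'rV[R]_(\dim W)) := linfun (mulmxr M).
have kerf : (lker f <= orthocompl W)%VS.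
  apply/subvP=> x; rewrite memv_ker lfunE /= => /eqP xM0.
  apply/mem_orthocomplP=> w /coord_vbasis ->; rewrite linear_sumr big1 // => i _.
  rewrite linearZr_LR /=; have /rowP/(_ i) := xM0; rewrite !mxE.
  by under eq_bigr do rewrite mxE; rewrite /dotp => ->; rewrite mulr0.
rewrite -(limg_ker_dim f fullv) capfv addnC leq_add ?dimvS //.
by rewrite (leq_trans (dimvS (subvf _))) // dimvf /dim /= mul1n.
Qed.

Lemma orthoproj_mem W x : orthoproj W x \in W.
Proof. exact: memv_pi. Qed.

Lemma orthoproj_perp W x : x - orthoproj W x \in orthocompl W.
Proof.
rewrite -{1}(daddv_pi_add (orthocompl_cap W) (w := x)) ?orthocompl_add ?memvf //.
by rewrite addrC addKr memv_pi.
Qed.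

(* Indexed from 1: stdvec k is e_k for 1 <= k <= d, and 0 otherwise. *)
Definition stdvec (k : nat) : 'rV[R]_d := \row_(j < d) (j.+1 == k)%:R.

(* The pair (eps, s) stands for the orthogonal map sending the i-th standard
   basis vector to (-1)^(eps i) times the (s i)-th one. *)
Definition hyperoct : finType := ({ffun 'I_d -> bool} * 'S_d)%type.

Definition hyperoct_mx (g : hyperoct) : 'M[R]_d :=
  diag_mx (\row_i (-1) ^+ g.1 i) *m perm_mx g.2.

Definition hyperoct_act (g : hyperoct) W : {vspace 'rV[R]_d} :=
  (linfun (mulmxr (hyperoct_mx g)) @: W)%VS.

Definition u0 (a : nat) : 'rV[R]_d :=
  (Num.sqrt a%:R)^-1 *: \sum_(1 <= i < a.+1) stdvec i.

Definition v0 (a b : nat) : 'rV[R]_d :=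
  (Num.sqrt b%:R)^-1 *: \sum_(a.+1 <= j < (a + b).+1) stdvec j.

Definition W0 (a b : nat) : {vspace 'rV[R]_d} := (<[u0 a]> + <[v0 a b]>)%VS.

Definition hyperoct_orbit (a b : nat) : {fset {vspace 'rV[R]_d}} :=
  [fset hyperoct_act g (W0 a b) | g : hyperoct]%fset.

Definition orbit_size (a b : nat) : nat := #|` hyperoct_orbit a b|%fset.

Definition frame_avg (X : {fset {vspace 'rV[R]_d}}) (x : 'rV[R]_d) : R :=
  (#|` X|%fset)%:R^-1 * \sum_(W <- X) norm2 (orthoproj W x) ^+ 4.

Definition frame_delta (X : {fset {vspace 'rV[R]_d}}) : R :=
  frame_avg X (stdvec 1)
  - frame_avg X ((Num.sqrt 2)^-1 *: (stdvec 1 + stdvec 2)).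

(* The first conjunct says that X is a subset of the Grassmannian G_{2,d}. *)
Definition tight_2fusion_frame (X : {fset {vspace 'rV[R]_d}}) : Prop :=
  (forall W, W \in X -> \dim W = 2%N) /\
  exists A : R, 0 < A /\
    forall x : 'rV[R]_d,
      \sum_(W <- X) norm2 (orthoproj W x) ^+ 4 = A * norm2 x ^+ 4.

End Euclidean.

Arguments hyperoct_orbit R d a b : clear implicits.
Arguments orbit_size R d a b : clear implicits.

(* Main.v *)
Require Import Defs.
From mathcomp Require Import all_boot all_order all_algebra perm.
From mathcomp Require Import finmap reals zify ring lra.

Set Implicit Arguments.
Unset Strict Implicit.
Unset Printing Implicit Defensive.

Import Order.TTheory GRing.Theory Num.Theory.
Local Open Scope ring_scope.

(** Write S(x) for the sum of the fourth powers of the norms of P_W x, W in X.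
    Each summand is the square of the quadratic form of the symmetric matrix p
    of P_W, so S is the quartic form whose coefficients are the moments
    T_ijkl, the sums over W in X of p_ij p_kl.  A union of orbits is stable
    under the signed permutations, hence so is T: flipping the sign of one
    coordinate kills each T_ijkl in which some index occurs an odd number of
    times, and since permutations act transitively on ordered pairs of
    distinct indices, the moments that are left take the same value on all
    pairs.  Therefore
      S(x) = beta * (sum of the x_i ^ 4) + gamma * |x| ^ 4
    ([quartic_sum_stable]), and X is tight exactly when beta vanishes.  Both
    e_1 and the diagonal unit vector (e_1 + e_2) / sqrt 2 have norm 1, while
    their coordinates have fourth powers summing to 1 and 1/2; so
    S(e_1) - S((e_1 + e_2) / sqrt 2) = beta / 2, and tightness amounts to the
    equality of these two values ([tight_iff_axis_diagonal]).  The frame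
    constant gamma is then positive, because S is positive at any nonzero
    vector of a plane of X.

    It remains to see that this difference is the weighted sum of the
    statement.  The weight N_d(a,b) cancels the averaging over the orbit, and
    the sum over the union splits along the orbits, provided that these are
    disjoint.  This holds because, for any function f, the sum of f over the
    diagonal of p is invariant under signed permutations; the plane W_0 has
    diagonal entries 1/a (a times), 1/b (b times) and 0, and so the choices
    f(r) = r/r and f(r) = 1/r, with 1/0 = 0, recover a + b and a^2 + b^2,
    hence the pair a <= b ([hyperoct_orbit_inj]). *)

(** * Orthogonal projections and their matrices *)

Section Projection.
Variables (R : realType) (d : nat).
Implicit Types (x y w : 'rV[R]_d) (W : {vspace 'rV[R]_d}).

Lemma dotpE x y : dotp x y = (x *m y^T) 0 0.
Proof. by rewrite mxE; apply: eq_bigr => i _; rewrite mxE. Qed.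

Lemma orthoproj_unique W x y :
  y \in W -> (forall w, w \in W -> dotp (x - y) w = 0) -> orthoproj W x = y.
Proof.
move=> yW xyW; apply/eqP; rewrite -subr_eq0 -memv0 -(orthocompl_cap W).
rewrite memv_cap rpredB ?orthoproj_mem //=.
have -> : orthoproj W x - y = (x - y) - (x - orthoproj W x).
  by rewrite opprB [RHS]addrC addrA subrK.
by rewrite rpredB ?orthoproj_perp //; apply/mem_orthocomplP.
Qed.

Lemma dotp_orthoproj W x w : w \in W -> dotp (orthoproj W x) w = dotp x w.
Proof.
move=> wW; have /mem_orthocomplP/(_ w wW) := orthoproj_perp W x.
by rewrite linearBl /= => /eqP; rewrite subr_eq0 => /eqP.
Qed.

Lemma dotp_orthoprojC W x y : dotp (orthoproj W x) y = dotp x (orthoproj W y).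
Proof.
by rewrite -(dotp_orthoproj x (orthoproj_mem W y)) dotpC
  -(dotp_orthoproj y (orthoproj_mem W x)) dotpC.
Qed.

Lemma dotp_sqr x : dotp x x = \sum_i x 0 i ^+ 2.
Proof. by apply: eq_bigr => i _; rewrite expr2. Qed.

Lemma norm2X4 x : norm2 x ^+ 4 = dotp x x ^+ 2.
Proof.
rewrite (exprM _ 2 2) sqr_sqrtr // dotp_sqr.
by apply: sumr_ge0 => i _; rewrite sqr_ge0.
Qed.

Lemma orthoproj_norm W x :
  dotp (orthoproj W x) (orthoproj W x) = dotp (orthoproj W x) x.
Proof. by rewrite dotpC (dotp_orthoproj _ (orthoproj_mem W x)) dotpC. Qed.

Definition projmx W : 'M[R]_d :=
  \matrix_(i, j) dotp (orthoproj W (delta_mx 0 i)) (delta_mx 0 j).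

Lemma dotp_delta x j : dotp x (delta_mx 0 j) = x 0 j.
Proof.
rewrite /dotp (bigD1 j) //= big1 ?addr0 => [|i /negPf ij].
  by rewrite mxE !eqxx mulr1.
by rewrite mxE ij andbF mulr0.
Qed.

Lemma orthoproj_projmx W x : orthoproj W x = x *m projmx W.
Proof.
apply/rowP=> j; rewrite [in LHS](row_sum_delta x) linear_sum summxE mxE.
by apply: eq_bigr => i _; rewrite linearZ /= !mxE dotp_delta.
Qed.

Lemma projmx_sym W i j : projmx W i j = projmx W j i.
Proof. by rewrite !mxE dotp_orthoprojC dotpC. Qed.

Lemma norm2_orthoprojX4 W x : norm2 (orthoproj W x) ^+ 4 =
  \sum_i \sum_j \sum_k \sum_l
    projmx W i j * projmx W k l * (x 0 i * x 0 j * x 0 k * x 0 l).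
Proof.
have -> : norm2 (orthoproj W x) ^+ 4 =
    (\sum_i \sum_j projmx W i j * (x 0 i * x 0 j)) ^+ 2.
  rewrite norm2X4 orthoproj_norm orthoproj_projmx; congr (_ ^+ 2).
  rewrite exchange_big; apply: eq_bigr => j _; rewrite mxE mulr_suml.
  by apply: eq_bigr => i _; ring.
rewrite expr2 mulr_suml; apply: eq_bigr => i _; rewrite mulr_suml.
apply: eq_bigr => j _; rewrite mulr_sumr; apply: eq_bigr => k _.
by rewrite mulr_sumr; apply: eq_bigr => l _; ring.
Qed.

End Projection.

(** * Signed permutations acting on subspaces *)

Section Action.
Variables (R : realType) (d : nat).
Implicit Types (x y w : 'rV[R]_d) (W : {vspace 'rV[R]_d}) (g h : hyperoct d).
Implicit Types X : {fset {vspace 'rV[R]_d}}.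

Local Notation mx g := (hyperoct_mx R g).

Lemma delta_hyperoct g i :
  delta_mx 0 i *m mx g = (-1) ^+ g.1 i *: delta_mx 0 (g.2 i) :> 'rV[R]_d.
Proof.
rewrite -rowE; apply/rowP=> j; rewrite !mxE (bigD1 i) //= !mxE eqxx mulr1n.
rewrite big1 => [|k /negPf ik]; first by rewrite addr0 eq_sym.
by rewrite !mxE eq_sym ik mul0r.
Qed.

Lemma hyperoct_mx_orth g : mx g *m (mx g)^T = 1%:M.
Proof.
rewrite /hyperoct_mx trmx_mul tr_diag_mx tr_perm_mx mulmxA.
rewrite -[_ *m _ *m perm_mx _]mulmxA -perm_mxM mulgV perm_mx1 mulmx1.
rewrite mulmx_diag -diag_const_mx.
by congr diag_mx; apply/rowP=> i; rewrite !mxE -signr_addb addbb.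
Qed.

Lemma dotp_hyperoct g x y : dotp (x *m mx g) (y *m mx g) = dotp x y.
Proof.
by rewrite !dotpE trmx_mul mulmxA -[x *m _ *m _]mulmxA hyperoct_mx_orth mulmx1.
Qed.

Lemma mulmx_hyperoct_inj g : injective (fun x => x *m mx g).
Proof.
apply: (can_inj (g := mulmx^~ (mx g)^T)) => x.
by rewrite -mulmxA hyperoct_mx_orth mulmx1.
Qed.

Lemma mem_hyperoct_act g W y :
  reflect (exists2 w, w \in W & y = w *m mx g) (y \in hyperoct_act g W).
Proof.
apply: (iffP memv_imgP) => -[w wW ->]; exists w => //; by rewrite lfunE.
Qed.

Lemma dim_hyperoct_act g W : \dim (hyperoct_act g W) = \dim W.
Proof.
apply: limg_dim_eq; apply/eqP; rewrite -subv0; apply/subvP=> x.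
rewrite memv_cap memv_ker lfunE /= => /andP[_ /eqP x0].
by rewrite memv0; apply/eqP/(@mulmx_hyperoct_inj g); rewrite /= x0 mul0mx.
Qed.

Lemma hyperoct_act_inj g : injective (@hyperoct_act R d g).
Proof.
move=> V W VW; apply/vspaceP=> x.
have E U : (x *m mx g \in hyperoct_act g U) = (x \in U).
  apply/mem_hyperoct_act/idP => [[w wU /mulmx_hyperoct_inj->]|xU] //.
  by exists x.
by rewrite -!E VW.
Qed.

Lemma orthoproj_hyperoct_act g W x :
  orthoproj (hyperoct_act g W) (x *m mx g) = orthoproj W x *m mx g.
Proof.
apply: orthoproj_unique => [|_ /mem_hyperoct_act[w wW ->]].
  by apply/mem_hyperoct_act; exists (orthoproj W x); rewrite ?orthoproj_mem.
rewrite -mulmxBl dotp_hyperoct.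
exact: (mem_orthocomplP _ _ (orthoproj_perp W x)).
Qed.

(** A signed permutation is orthogonal, so it conjugates projections; on
    matrix entries this only permutes indices and changes signs. *)
Lemma projmx_hyperoct_act g W i j :
  projmx (hyperoct_act g W) (g.2 i) (g.2 j) =
  (-1) ^+ (g.1 i (+) g.1 j) * projmx W i j.
Proof.
have E k : delta_mx 0 (g.2 k) =
    ((-1) ^+ g.1 k *: delta_mx 0 k) *m mx g :> 'rV[R]_d.
  by rewrite -scalemxAl delta_hyperoct scalerA -signr_addb addbb scale1r.
rewrite !mxE !E orthoproj_hyperoct_act dotp_hyperoct linearZ /=.
by rewrite linearZl_LR linearZr_LR /= signr_addb mulrA.
Qed.

(** Row vectors are acted on from the right: [g] comes first, then [h]. *)
Definition hyperoct_mul g h : hyperoct d :=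
  ([ffun i => g.1 i (+) h.1 (g.2 i)], (g.2 * h.2)%g).

Lemma hyperoct_mxM g h : mx (hyperoct_mul g h) = mx g *m mx h.
Proof.
apply/row_matrixP=> i; rewrite !rowE mulmxA !delta_hyperoct -scalemxAl.
by rewrite delta_hyperoct scalerA -signr_addb ffunE permM.
Qed.

Lemma hyperoct_actM g h W :
  hyperoct_act h (hyperoct_act g W) = hyperoct_act (hyperoct_mul g h) W.
Proof.
apply/vspaceP=> y; apply/mem_hyperoct_act/mem_hyperoct_act.
  move=> [_ /mem_hyperoct_act[w wW ->] ->]; exists w => //.
  by rewrite hyperoct_mxM -mulmxA.
move=> [w wW ->]; exists (w *m mx g); last by rewrite hyperoct_mxM -mulmxA.
by apply/mem_hyperoct_act; exists w.
Qed.

Definition hyperoct_stable X :=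
  forall g W, W \in X -> hyperoct_act g W \in X.

Lemma hyperoct_orbitP a b W :
  reflect (exists g, W = hyperoct_act g (W0 R d a b))
          (W \in hyperoct_orbit R d a b).
Proof.
by apply: (iffP (imfsetP _ _ _ _)) => [[g _ ->]|[g ->]]; exists g.
Qed.

Lemma hyperoct_orbit_stable a b : hyperoct_stable (hyperoct_orbit R d a b).
Proof.
move=> g _ /hyperoct_orbitP[h ->]; apply/hyperoct_orbitP.
by exists (hyperoct_mul h g); rewrite hyperoct_actM.
Qed.

(** The action of [g] is injective, so it permutes the finite set [X]. *)
Lemma sum_hyperoct_act X g (f : {vspace 'rV[R]_d} -> R) : hyperoct_stable X ->
  \sum_(W <- X) f (hyperoct_act g W) = \sum_(W <- X) f W.
Proof.
move=> stX; rewrite -(big_map (hyperoct_act g) predT f); apply: perm_big.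
have uX : uniq [seq hyperoct_act g W | W <- X].
  by rewrite map_inj_uniq ?fset_uniq //; exact: hyperoct_act_inj.
have [_ /mapP[W WX ->]||_ eqX] := uniq_min_size uX (s2 := X).
- exact: stX.
- by rewrite size_map.
- exact: uniq_perm uX (fset_uniq X) eqX.
Qed.

End Action.

(** * Quartic forms of stable sets of subspaces *)

Lemma perm_2trans d (i0 i1 i j : 'I_d) : i0 != i1 -> i != j ->
  exists s : 'S_d, s i0 = i /\ s i1 = j.
Proof.
move=> i01 ij; exists (tperm i0 i * tperm (tperm i0 i i1) j)%g.
rewrite !permM tpermL; split; last exact: tpermL.
apply: tpermD; rewrite 1?eq_sym // -[X in X != _](tpermL i0 i).
by rewrite (inj_eq perm_inj).
Qed.

Section Quartic.
Variables (R : realType) (d : nat).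
Implicit Types (x : 'rV[R]_d) (W : {vspace 'rV[R]_d}).
Variable X : {fset {vspace 'rV[R]_d}}.
Hypothesis stX : hyperoct_stable X.

Definition quartic_sum x : R := \sum_(W <- X) norm2 (orthoproj W x) ^+ 4.

Definition moment i j k l : R := \sum_(W <- X) projmx W i j * projmx W k l.

Lemma quartic_sumE x : quartic_sum x =
  \sum_i \sum_j \sum_k \sum_l
    moment i j k l * (x 0 i * x 0 j * x 0 k * x 0 l).
Proof.
rewrite /quartic_sum (eq_bigr _ (fun W _ => norm2_orthoprojX4 W x)).
rewrite exchange_big; apply: eq_bigr => i _.
rewrite exchange_big; apply: eq_bigr => j _.
rewrite exchange_big; apply: eq_bigr => k _.
by rewrite exchange_big; apply: eq_bigr => l _; rewrite mulr_suml.
Qed.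

Lemma moment_hyperoct (g : hyperoct d) i j k l :
  moment (g.2 i) (g.2 j) (g.2 k) (g.2 l) =
  (-1) ^+ (g.1 i (+) g.1 j (+) (g.1 k (+) g.1 l)) * moment i j k l.
Proof.
rewrite /moment -(sum_hyperoct_act g _ stX) mulr_sumr; apply: eq_bigr => W _.
rewrite (projmx_hyperoct_act g W i j) (projmx_hyperoct_act g W k l).
by rewrite mulrACA -signr_addb.
Qed.

Lemma moment_perm (s : 'S_d) i j k l :
  moment (s i) (s j) (s k) (s l) = moment i j k l.
Proof.
have /= -> := moment_hyperoct ([ffun => false], s) i j k l.
by rewrite !ffunE mul1r.
Qed.

(** Changing the sign of the coordinate [q] alone multiplies the moment by -1
    when [q] occurs an odd number of times among its indices. *)
Lemma moment_odd_eq0 q i j k l :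
  (i == q) (+) (j == q) (+) ((k == q) (+) (l == q)) -> moment i j k l = 0.
Proof.
move=> odd_q.
have := moment_hyperoct ([ffun r => r == q], 1%g) i j k l.
rewrite /= !perm1 !ffunE odd_q expr1 mulN1r => /eqP.
by rewrite -addr_eq0 -mulr2n mulrn_eq0 => /eqP.
Qed.

Lemma moment_sym i j k l : moment i j k l = moment i j l k.
Proof. by apply: eq_bigr => W _; rewrite (projmx_sym W k). Qed.

Lemma sum_moment_diag x i :
  \sum_k \sum_l moment i i k l * (x 0 i * x 0 i * x 0 k * x 0 l) =
  x 0 i ^+ 2 * \sum_k moment i i k k * x 0 k ^+ 2.
Proof.
rewrite mulr_sumr; apply: eq_bigr => k _.
rewrite (bigD1 k) //= big1 => [|l /negPf lk]; first by ring.
by rewrite (@moment_odd_eq0 k) ?mul0r // eqxx lk addbb.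
Qed.

(** For distinct [i] and [j], parity leaves only the terms in which (k, l) is
    (i, j) or (j, i), and these are equal by symmetry of the matrices. *)
Lemma sum_moment_offdiag x i j : i != j ->
  \sum_k \sum_l moment i j k l * (x 0 i * x 0 j * x 0 k * x 0 l) =
  2 * moment i j i j * (x 0 i ^+ 2 * x 0 j ^+ 2).
Proof.
move=> ij; have ji : j != i by rewrite eq_sym.
rewrite (bigD1 i) //= (bigD1 j ji) /= [X in _ + (_ + X)]big1 ?addr0; last first.
  move=> k /andP[ki kj]; apply: big1 => l _.
  have [->|li] := eqVneq l j.
    by rewrite (@moment_odd_eq0 i) ?mul0r // eqxx (negPf ji) (negPf ki).
  rewrite (@moment_odd_eq0 j) ?mul0r //.
  by rewrite eqxx (negPf ij) (negPf kj) (negPf li).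
rewrite (bigD1 j)  //= big1 => [|l /negPf lj]; last first.
  by rewrite (@moment_odd_eq0 j) ?mul0r // eqxx lj (negPf ij).
rewrite (bigD1 i) //= big1 => [|l /negPf li]; last first.
  by rewrite (@moment_odd_eq0 i) ?mul0r // eqxx li (negPf ji).
by rewrite (moment_sym i j j i); ring.
Qed.

(** By transitivity on ordered pairs, the moments at [i0] and [i1] give the
    coefficient [alpha] of every x_i ^ 4 and the coefficient [gamma] of
    x_i ^ 2 * x_j ^ 2 for every ordered pair of distinct indices.  As
    gamma * |x| ^ 4 already contains gamma * x_i ^ 4, what is left for [beta]
    is [alpha - gamma]. *)
Lemma quartic_sum_stable (i0 i1 : 'I_d) : i0 != i1 ->
  exists beta gamma : R, forall x,
    quartic_sum x = beta * (\sum_i x 0 i ^+ 4) + gamma * dotp x x ^+ 2.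
Proof.
move=> i01; pose alpha := moment i0 i0 i0 i0.
pose gamma := moment i0 i0 i1 i1 + 2 * moment i0 i1 i0 i1.
exists (alpha - gamma), gamma => x.
have diagE i : moment i i i i = alpha.
  by rewrite -(tpermL i0 i) moment_perm.
have offE i j : i != j -> moment i i j j + 2 * moment i j i j = gamma.
  by move=> ij; have [s [<- <-]] := perm_2trans i01 ij; rewrite !moment_perm.
have rowE i : \sum_j \sum_k \sum_l
      moment i j k l * (x 0 i * x 0 j * x 0 k * x 0 l) =
    (alpha - gamma) * x 0 i ^+ 4 + gamma * (x 0 i ^+ 2 * dotp x x).
  rewrite (bigD1 i) //= sum_moment_diag.
  have ne j : j != i -> i != j by rewrite eq_sym.
  rewrite (eq_bigr _ (fun j ji => sum_moment_offdiag x (ne j ji))).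
  rewrite (bigD1 i) //= diagE mulrDr -addrA mulr_sumr -big_split /=.
  rewrite (eq_bigr (fun j => gamma * x 0 i ^+ 2 * x 0 j ^+ 2)) => [|j ji].
    have -> : dotp x x = x 0 i ^+ 2 + \sum_(j | j != i) x 0 j ^+ 2.
      by rewrite /dotp (bigD1 i) //=; congr (_ + _); apply: eq_bigr.
    by rewrite -mulr_sumr; ring.
  by rewrite -(offE i j (ne j ji)); ring.
rewrite quartic_sumE (eq_bigr _ (fun i _ => rowE i)) big_split /= -!mulr_sumr.
rewrite -mulr_suml; congr (_ + _ * _); rewrite expr2; congr (_ * _).
Qed.

End Quartic.

(** * Tightness from two values *)

Section Tightness.
Variables (R : realType) (d : nat).
Hypothesis d_gt1 : (1 < d)%N.
Implicit Types (x : 'rV[R]_d) (X : {fset {vspace 'rV[R]_d}}).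

Definition diagonal_vec : 'rV[R]_d :=
  (Num.sqrt 2)^-1 *: (stdvec R d 1 + stdvec R d 2).

Lemma sum_stdvec1 (f : R -> R) : f 0 = 0 -> \sum_i f (stdvec R d 1 0 i) = f 1.
Proof.
move=> f0; rewrite (bigD1 (Ordinal (ltnW d_gt1))) //= big1 => [|i].
  by rewrite mxE addr0.
by rewrite -val_eqE mxE eqSS /= => /negPf->.
Qed.

Lemma sum_diagonal_vec (f : R -> R) :
  f 0 = 0 -> \sum_i f (diagonal_vec 0 i) = f (Num.sqrt 2)^-1 *+ 2.
Proof.
move=> f0.
rewrite (bigD1 (Ordinal (ltnW d_gt1))) // (bigD1 (Ordinal d_gt1)) //=.
rewrite big1 => [|i]; first by rewrite !mxE /= add0r !addr0 mulr1.
rewrite -!val_eqE !mxE !eqSS /= => /andP[/negPf-> /negPf->].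
by rewrite addr0 mulr0.
Qed.

Lemma dotp_stdvec1 : dotp (stdvec R d 1) (stdvec R d 1) = 1.
Proof.
by rewrite dotp_sqr (sum_stdvec1 (f := fun r => r ^+ 2)) ?expr0n ?expr1n.
Qed.

Lemma sqr_invsqrt2 : (Num.sqrt 2 : R)^-1 ^+ 2 = 2^-1.
Proof. by rewrite exprVn sqr_sqrtr ?ler0n. Qed.

Lemma dotp_diagonal_vec : dotp diagonal_vec diagonal_vec = 1.
Proof.
rewrite dotp_sqr (sum_diagonal_vec (f := fun r => r ^+ 2)) ?expr0n //.
by rewrite sqr_invsqrt2; field.
Qed.

(** The two unit vectors separate the form sum of the x_i ^ 4 from |x| ^ 4, so
    equal values force its coefficient [beta] to vanish. *)
Lemma tight_iff_axis_diagonal X W :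
    hyperoct_stable X -> (forall V, V \in X -> \dim V = 2%N) -> W \in X ->
  tight_2fusion_frame X <->
  quartic_sum X (stdvec R d 1) = quartic_sum X diagonal_vec.
Proof.
move=> stX dimX WX; split=> [[_ [A [_ SA]]]|eqS].
  by rewrite /quartic_sum !SA !norm2X4 dotp_stdvec1 dotp_diagonal_vec.
have i01 : Ordinal (ltnW d_gt1) != Ordinal d_gt1 by [].
have [beta [gamma S]] := quartic_sum_stable stX i01.
have beta0 : beta = 0.
  move: eqS; rewrite !S dotp_stdvec1 dotp_diagonal_vec => /addIr.
  rewrite (sum_stdvec1 (f := fun r => r ^+ 4)) ?expr0n //.
  rewrite (sum_diagonal_vec (f := fun r => r ^+ 4)) ?expr0n //.
  rewrite expr1n (exprM _ 2 2) sqr_invsqrt2; lra.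
split=> //; exists gamma; split; last first.
  by move=> x; rewrite -[LHS]/(quartic_sum X x) S beta0 mul0r add0r norm2X4.
(* A nonzero vector of W is fixed by P_W, so S is positive there. *)
have w0 : vpick W != 0 by rewrite vpick0 -dimv_eq0 dimX.
have ww : 0 < dotp (vpick W) (vpick W) ^+ 2 by rewrite exprn_gt0 ?dotp_gt0.
have : 0 < quartic_sum X (vpick W).
  rewrite /quartic_sum (big_fsetD1 W) //= ltr_wpDr //.
    by apply: sumr_ge0 => V _; rewrite exprn_ge0 // sqrtr_ge0.
  rewrite (orthoproj_unique (y := vpick W)) ?memv_pick ?norm2X4 // => w _.
  by rewrite subrr linear0l.
by rewrite S beta0 mul0r add0r pmulr_lgt0.
Qed.

End Tightness.

(** * The model plane *)

Section OrthonormalPair.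
Variables (R : realType) (d : nat) (u v : 'rV[R]_d).
Hypotheses (uu : dotp u u = 1) (vv : dotp v v = 1) (uv : dotp u v = 0).

Lemma dim_orthonormal_span : \dim (<[u]> + <[v]>) = 2%N.
Proof.
have nz x : dotp x x = 1 :> R -> x != 0 :> 'rV_d.
  by apply: contra_eq_neq => ->; rewrite linear0l eq_sym oner_neq0.
rewrite dimv_disjoint_sum ?dim_vline ?nz //.
apply/eqP; rewrite -subv0; apply/subvP=> x; rewrite memv_cap memv0.
case/andP=> /vlineP[c ->] /vlineP[e /(congr1 (dotp u))].
by rewrite !linearZr_LR /= uu uv mulr0 mulr1 => ->; rewrite scale0r.
Qed.

Lemma orthoproj_orthonormal_span x :
  orthoproj (<[u]> + <[v]>) x = dotp x u *: u + dotp x v *: v.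
Proof.
apply: orthoproj_unique => [|w].
  by rewrite memv_add // rpredZ // memv_line.
move=> /memv_addP[_ /vlineP[c ->] [_ /vlineP[e ->] ->]].
have vu : dotp v u = 0 by rewrite dotpC.
rewrite linearDr /= !linearZr_LR /= !linearBl /= !linearDl /= !linearZl_LR /=.
by rewrite uu uv vu vv !(mulr0, mulr1, addr0, add0r) !subrr !mulr0 addr0.
Qed.

End OrthonormalPair.

Section ModelPlane.
Variables (R : realType) (d a b : nat).
Hypotheses (a_gt0 : (0 < a)%N) (b_gt0 : (0 < b)%N) (ab_le : (a + b <= d)%N).

Lemma sum_stdvecE m n (j : 'I_d) :
  (\sum_(m <= i < n) stdvec R d i) 0 j = (m <= j.+1 < n)%N%:R.
Proof.
rewrite summxE (eq_bigr (fun i => if i == j.+1 then 1 else 0 : R)) => [|i _].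
  by rewrite -big_mkcond big_nat1_eq; case: ifP.
by rewrite mxE eq_sym; case: eqP.
Qed.

Lemma u0E j : u0 R d a 0 j = (Num.sqrt a%:R)^-1 * (j < a)%N%:R.
Proof. by rewrite mxE sum_stdvecE. Qed.

Lemma v0E j : v0 R d a b 0 j = (Num.sqrt b%:R)^-1 * (a <= j < a + b)%N%:R.
Proof. by rewrite mxE sum_stdvecE. Qed.

Lemma sum_interval (c : R) m n : (m + n <= d)%N ->
  \sum_(i < d) c * (m <= i < m + n)%N%:R = c * n%:R.
Proof.
move=> mnd; rewrite -mulr_sumr; congr (_ * _).
rewrite -(big_mkord xpredT (fun i => (m <= i < m + n)%N%:R : R)).
rewrite (big_cat_nat _ mnd) //= (big_cat_nat _ (leq_addr n m)) //=.
rewrite big_nat big1 => [|i /andP[_ im]]; last by rewrite leqNgt im.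
rewrite [X in _ + X]big_nat [X in _ + X]big1 => [|i /andP[im _]]; last first.
  by rewrite [(i < _)%N]ltnNge im andbF.
rewrite add0r addr0 big_nat (eq_bigr (fun=> 1)) => [|i ->] //.
by rewrite -big_nat sumr_const_nat addKn.
Qed.

Lemma invsqrt_sqr n : (Num.sqrt n%:R : R)^-1 * (Num.sqrt n%:R)^-1 = n%:R^-1.
Proof. by rewrite -invfM -expr2 sqr_sqrtr ?ler0n. Qed.

Lemma dotp_u0u0 : dotp (u0 R d a) (u0 R d a) = 1.
Proof.
rewrite /dotp.
rewrite (eq_bigr (fun i : 'I_d => a%:R^-1 * (0 <= i < 0 + a)%N%:R)) => [|i _].
  rewrite sum_interval ?mulVf ?pnatr_eq0 -?lt0n //.
  exact: leq_trans (leq_addr b a) ab_le.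
rewrite u0E mulrACA invsqrt_sqr add0n.
by case: (_ < _)%N; rewrite ?mulr1 ?mulr0.
Qed.

Lemma dotp_v0v0 : dotp (v0 R d a b) (v0 R d a b) = 1.
Proof.
rewrite /dotp.
rewrite (eq_bigr (fun i : 'I_d => b%:R^-1 * (a <= i < a + b)%N%:R)) => [|i _].
  by rewrite sum_interval ?mulVf ?pnatr_eq0 -?lt0n.
by rewrite v0E mulrACA invsqrt_sqr; case: (_ <= _ < _)%N; rewrite ?mulr1 ?mulr0.
Qed.

Lemma dotp_u0v0 : dotp (u0 R d a) (v0 R d a b) = 0.
Proof.
apply: big1 => i _; rewrite u0E v0E [(a <= i)%N]leqNgt.
by case: (_ < a)%N; rewrite ?mulr0 ?mul0r.
Qed.

Lemma dim_W0 : \dim (W0 R d a b) = 2%N.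
Proof. exact: dim_orthonormal_span dotp_u0u0 dotp_v0v0 dotp_u0v0. Qed.

Lemma orthoproj_W0 x : orthoproj (W0 R d a b) x =
  dotp x (u0 R d a) *: u0 R d a + dotp x (v0 R d a b) *: v0 R d a b.
Proof. exact: orthoproj_orthonormal_span dotp_u0u0 dotp_v0v0 dotp_u0v0 x. Qed.

(** With [f] arbitrary, these sums determine the multiset of the diagonal
    entries of the projection, an invariant of the orbit. *)
Definition diag_sum (f : R -> R) (W : {vspace 'rV[R]_d}) : R :=
  \sum_i f (projmx W i i).

Lemma diag_sum_W0 f : f 0 = 0 ->
  diag_sum f (W0 R d a b) = f a%:R^-1 * a%:R + f b%:R^-1 * b%:R.
Proof.
move=> f0.
rewrite -(@sum_interval _ 0 a); last exact: leq_trans (leq_addr b a) ab_le.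
rewrite -(@sum_interval _ a b) // -big_split; apply: eq_bigr => i _ /=.
have deltaE y : dotp (delta_mx 0 i) y = y 0 i by rewrite dotpC dotp_delta.
rewrite mxE orthoproj_W0 !deltaE dotp_delta mxE [X in X + _]mxE [X in _ + X]mxE.
rewrite u0E v0E mulrACA [X in _ + X]mulrACA !invsqrt_sqr add0n /=.
case: ltnP => _ /=; first by rewrite !mulr1 !mulr0 !addr0.
by case: ltnP => _ /=; rewrite !(mulr1, mulr0, add0r) ?f0.
Qed.

End ModelPlane.

(** * Disjointness of the orbits *)

Section Disjointness.
Variables (R : realType) (d : nat).

(** Both signs attached to a diagonal entry are the same, hence cancel. *)
Lemma diag_sum_hyperoct_act (f : R -> R) g (W : {vspace 'rV[R]_d}) :
  diag_sum f (hyperoct_act g W) = diag_sum f W.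
Proof.
rewrite /diag_sum (reindex_inj (@perm_inj _ g.2)); apply: eq_bigr => i _.
by rewrite (projmx_hyperoct_act g W i i) addbb mul1r.
Qed.

(** The invariants [a + b] and [a ^ 2 + b ^ 2] determine the unordered pair, and
    [a <= b] orders it. *)
Lemma hyperoct_orbit_inj a b a' b' (W : {vspace 'rV[R]_d}) :
    (1 <= a <= b)%N /\ (a + b <= d)%N ->
    (1 <= a' <= b')%N /\ (a' + b' <= d)%N ->
    W \in hyperoct_orbit R d a b -> W \in hyperoct_orbit R d a' b' ->
  (a, b) = (a', b').
Proof.
move=> [/andP[a0 ab] abd] [/andP[a'0 ab'] abd'].
move=> /hyperoct_orbitP[g ->] /hyperoct_orbitP[h ghE].
have b0 := leq_trans a0 ab; have b'0 := leq_trans a'0 ab'.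
have nz n : (0 < n)%N -> n%:R != 0 :> R by rewrite pnatr_eq0 -lt0n.
have inv (f : R -> R) : f 0 = 0 ->
    f a%:R^-1 * a%:R + f b%:R^-1 * b%:R =
    f a'%:R^-1 * a'%:R + f b'%:R^-1 * b'%:R.
  move=> f0.
  rewrite -(diag_sum_W0 a0 b0 abd f0) -(diag_sum_W0 a'0 b'0 abd' f0).
  by rewrite -(diag_sum_hyperoct_act f g) ghE diag_sum_hyperoct_act.
(* As r / r is 1 for r != 0 and 0 for r = 0, it counts nonzero entries. *)
have sum_eq : (a + b = a' + b')%N.
  have := inv (fun r => r / r) (mul0r _).
  rewrite !divff ?invr_eq0 ?nz // !mul1r -!natrD => /eqP.
  by rewrite eqr_nat => /eqP.
have sqr_eq : (a * a + b * b = a' * a' + b' * b')%N.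
  have := inv (fun r => r^-1) (invr0 _).
  by rewrite !invrK -!natrM -!natrD => /eqP; rewrite eqr_nat => /eqP.
by congr (_, _); nia.
Qed.

End Disjointness.

Lemma sum_disjoint_bigfcup (R : realType) (T : choiceType) (I : finType)
    (F : I -> {fset T}) (f : T -> R) :
    (forall i j x, x \in F i -> x \in F j -> i = j) ->
  \sum_(x <- (\bigcup_(i in I) F i)%fset) f x = \sum_i \sum_(x <- F i) f x.
Proof.
move=> inj; pose K := [fset i | i in I]%fset.
have eqK : perm_eq (index_enum I) K.
  apply: uniq_perm; rewrite ?index_enum_uniq ?fset_uniq // => i.
  by rewrite mem_index_enum; apply/esym/imfsetP; exists i.
rewrite (perm_big _ eqK) /= [RHS](perm_big _ eqK) /=.
rewrite partition_disjoint_bigfcup // => i j _ _ ij.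
apply/fdisjointP => x xi; apply: contra ij => xj.
by apply/eqP; exact: inj xi xj.
Qed.

(** * The equivalence *)

Lemma orbit_sizeM_frame_avg (R : realType) (d a b : nat) (x : 'rV[R]_d) :
  (orbit_size R d a b)%:R * frame_avg (hyperoct_orbit R d a b) x =
  quartic_sum (hyperoct_orbit R d a b) x.
Proof.
rewrite /frame_avg mulVKf // pnatr_eq0 cardfs_eq0.
apply/fset0Pn; exists (hyperoct_act ([ffun=> false], 1%g) (W0 R d a b)).
by apply/hyperoct_orbitP; eexists.
Qed.

Theorem theorem4p7 (R : realType) (d : nat) (hd : (4 <= d)%N)
    (m : nat) (hm : (0 < m)%N) (a b : 'I_m -> nat)
    (hdistinct : injective (fun t : 'I_m => (a t, b t)))
    (hab : forall t : 'I_m, (1 <= a t <= b t)%N /\ (a t + b t <= d)%N) :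
  tight_2fusion_frame (\bigcup_(t in 'I_m) hyperoct_orbit R d (a t) (b t))%fset
  <->
  \sum_(t < m) (orbit_size R d (a t) (b t))%:R
               * frame_delta (hyperoct_orbit R d (a t) (b t)) = 0.
Proof.
set X := (\bigcup_(t in _) _)%fset.
have d_gt1 : (1 < d)%N by apply: leq_trans hd.
have memX W :
    reflect (exists t, W \in hyperoct_orbit R d (a t) (b t)) (W \in X).
  apply: (iffP (bigfcupP _ _ _ _)) => [[t _ Wt]|[t Wt]]; exists t => //.
  by rewrite mem_index_enum.
have stX : hyperoct_stable X.
  move=> g W /memX[t Wt]; apply/memX; exists t.
  exact: hyperoct_orbit_stable.
have dimX W : W \in X -> \dim W = 2%N.
  move=> /memX[t /hyperoct_orbitP[g ->]]; rewrite dim_hyperoct_act.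
  have [/andP[a0 ab] abd] := hab t; apply: dim_W0 => //.
  exact: leq_trans ab.
pose t0 := Ordinal hm.
have WX : hyperoct_act ([ffun=> false], 1%g) (W0 R d (a t0) (b t0)) \in X.
  by apply/memX; exists t0; apply/hyperoct_orbitP; eexists.
have sumX x : quartic_sum X x =
    \sum_t quartic_sum (hyperoct_orbit R d (a t) (b t)) x.
  apply: sum_disjoint_bigfcup => t t' W Wt Wt'; apply: hdistinct.
  exact: hyperoct_orbit_inj (hab t) (hab t') Wt Wt'.
have deltaE t : (orbit_size R d (a t) (b t))%:R *
      frame_delta (hyperoct_orbit R d (a t) (b t)) =
    quartic_sum (hyperoct_orbit R d (a t) (b t)) (stdvec R d 1) -
    quartic_sum (hyperoct_orbit R d (a t) (b t)) (diagonal_vec R d).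
  by rewrite mulrBr !orbit_sizeM_frame_avg.
rewrite (tight_iff_axis_diagonal d_gt1 stX dimX WX).
rewrite (eq_bigr _ (fun t _ => deltaE t)) sumrB -!sumX.
by split=> [->|/eqP]; [rewrite subrr | rewrite subr_eq0 => /eqP].
Qed.
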